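(* Let $m\ge 1$, let $a_1,\ldots,a_n$ ($n\ge1$) be positive integers, and let $X=(X_{ij})_{1\le i,j\le m+1}$ be the matrix product $X=\Lambda^{(m)}(a_1)\cdots\Lambda^{(m)}(a_n)$. Then for all $1\le i,j\le m+1$, \[ X_{i,j}={}^{m+1-i}[\![1,a_1,\ldots,a_n,1]\!]_m^{m+1-j}. \] In particular, the top-left entry is \[ X_{1,1}={}^{m}[\![1,a_1,\ldots,a_n,1]\!]_m^{m}=[\![a_1,\ldots,a_n]\!]_m. \]
   Context: An $m$-dimer cover of a graph is a multiset of edges such that every vertex is incident to exactly $m$ edges of the multiset (counted with multiplicity). For an $m$-dimer cover $p$ and an edge $e$, $p(e)$ is the multiplicity of $e$ in $p$. $\mathcal{G}[1^N]$ denotes the straight snake graph: a horizontal row of $N-1$ unit squares, consecutive squares glued along vertical edges, whose vertical edges are $e_1,\ldots,e_N$ from left to right (a single vertical edge $e_1$ if $N=1$). $\Omega_m[1^N]$ is the set of its $m$-dimer covers. For positive integers $c_1,\ldots,c_N$ and $p\in\Omega_m[1^N]$ set $\mathrm{wt}_p(e_i)=\binom{c_i+k-1}{k}$ where $k=p(e_i)$. Define \[ [\![c_1,\ldots,c_N]\!]_m=\sum_{p\in\Omega_m[1^N]}\prod_{i=1}^N \mathrm{wt}_p(e_i), \] and, for $0\le i,j\le m$, define ${}^{i}[\![c_1,\ldots,c_N]\!]_m^{j}$ to be the same sum restricted to those $p\in\Omega_m[1^N]$ with $p(e_1)=i$ and $p(e_N)=j$. In particular $[\![a]\!]_k=\binom{a+k-1}{k}$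 for $k\ge 0$; set $[\![a]\!]_k=0$ for $k<0$. $\Lambda^{(m)}(a)$ is the $(m+1)\times(m+1)$ matrix whose $(i,j)$-entry is $[\![a]\!]_{m+2-i-j}$. *)

(* Defs.v *)
From HB Require Import structures.
From mathcomp Require Import all_boot all_order all_algebra.

Set Implicit Arguments.
Unset Strict Implicit.
Unset Printing Implicit Defensive.

Import GRing.Theory.

(* A finite graph is given by its types V of vertices and E of edges and by
   its incidence relation; a multiset of edges is its multiplicity function. *)
Definition dimer_cover (V E : finType) (inc : V -> E -> bool) (m : nat)
    (p : E -> nat) : bool :=
  [forall v : V, \sum_(e : E | inc v e) p e == m].

(* The straight snake graph with N columns: (b, i) is the vertex of column i
   in the bottom (b = false) or top (b = true) row; inl k is the vertical edge
   in column k, and inr (b, k) is the horizontal edge joining (b, k) to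
   (b, k.+1). Columns are numbered from 0. *)
Definition snake_vertex (N : nat) : finType := (bool * 'I_N)%type.

Definition snake_edge (N : nat) : finType := ('I_N + bool * 'I_N.-1)%type.

Definition snake_inc (N : nat) (v : snake_vertex N) (e : snake_edge N) : bool :=
  match e with
  | inl k => v.2 == k
  | inr (b, k) =>
      (v.1 == b) && ((v.2 == k :> nat) || (v.2 == k.+1 :> nat))
  end.

Definition vert (N : nat) (k : 'I_N) : snake_edge N := inl k.

(* No edge of an m-dimer cover has multiplicity greater than m, so the set of
   all m-dimer covers is found among the functions with values in 'I_m.+1. *)
Lemma snake_cover_bound (N m : nat) (p : snake_edge N -> nat) :
  dimer_cover (@snake_inc N) m p -> forall e, p e <= m.
Proof.
move=> /forallP cov e.
have [v ve] : exists v, snake_inc v e.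
  case: e => [k|[b k]]; first by exists (true, k) => /=.
  have ltkN : k < N by apply: leq_trans (ltn_ord k) (leq_pred N).
  by exists (b, Ordinal ltkN); rewrite /= !eqxx.
by rewrite -(eqP (cov v)) (bigD1 e) //= leq_addr.
Qed.

Definition Omega (m N : nat) : {set {ffun snake_edge N -> 'I_m.+1}} :=
  [set p : {ffun snake_edge N -> 'I_m.+1} |
    dimer_cover (@snake_inc N) m (fun e => p e : nat)].

Definition wt (m N : nat) (c : N.-tuple nat)
    (p : {ffun snake_edge N -> 'I_m.+1}) (i : 'I_N) : nat :=
  let k : nat := p (vert i) in 'C(tnth c i + k - 1, k).

Definition bracket (m N : nat) (c : N.-tuple nat) : nat :=
  \sum_(p in Omega m N) \prod_(i < N) wt c p i.

(* bracket_bd m i j c restricts to the covers with prescribed multiplicities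
   i and j of the first and last vertical edges. *)
Definition bracket_bd (m i j N : nat) (c : N.+1.-tuple nat) : nat :=
  \sum_(p in Omega m N.+1 |
          (p (vert ord0) == i :> nat) && (p (vert ord_max) == j :> nat))
    \prod_(k < N.+1) wt c p k.

Definition bracketz (k : int) (a : nat) : nat :=
  match k with
  | Posz k => bracket k [tuple a]
  | Negz _ => 0
  end.

(* Matrix indices start at 0, whence the successors. *)
Definition Lambda (m a : nat) : 'M[int]_m.+1 :=
  (\matrix_(i, j) (bracketz (m%:Z + 2 - i.+1%:Z - j.+1%:Z) a)%:Z)%R.

(* Main.v *)
Require Import Defs.
From HB Require Import structures.
From mathcomp Require Import all_boot all_order all_algebra.
From mathcomp Require Import zify.

Set Implicit Arguments.
Unset Strict Implicit.
Unset Printing Implicit Defensive.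

Import GRing.Theory.

(** The proof is a transfer matrix argument. In an m-dimer cover of the straight
    snake graph, the condition at the row b vertex of column k says that the
    multiplicities of the horizontal edges to its left and to its right and of
    the vertical edge e_k add up to m. The vertical edge belongs to both rows
    and there is no horizontal edge before the first column, so the top and
    bottom horizontal edges between two consecutive columns have the same
    multiplicity ([flow_sym]). A cover is therefore the same thing as a path
    h_0, ..., h_N in {0, ..., m} with h_0 = h_N = 0 and h_k + h_(k+1) <= m for
    all k, the multiplicity of e_k being m - h_k - h_(k+1).

    A sum over such paths of a product of weights, one per step, is an entry of
    a product of matrices ([mx_prod_path]). Hence for arbitrary weights f_k the
    generating function of the covers is the top-left entry of the product of
    the matrices with entries f_k (m - i - j) for i + j <= m and 0 otherwise
    ([cover_sum_transfer]). With the binomial weights these are the matrices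
    Lambda, because the bracket of one column is the binomial itself
    ([Lambda_transfer]); this computes the bracket of a as X_00.

    For the other entries, the columns of label 1 at both ends of (1, a, 1)
    have binomial weight 1, so prescribing the multiplicities p and q of the end
    edges amounts to giving these columns the weights [v == p] and [v == q]
    ([bracket_bd_transfer]). The first row of the first transfer matrix and the
    first column of the last one are then unit vectors, which pick out of X the
    entry at (m - p, m - q) ([transfer_delta]). *)

(** * Matrix products as sums over paths *)

(** Paths are indexed through [inord], so that consecutive positions k and k.+1
    are written alike at both ends of a step. The induction peels off the first
    step of the path. *)
Lemma mx_prod_path (R : nzRingType) (d N : nat) (A : 'I_N -> 'M[R]_d.+1)
    (i j : 'I_d.+1) :
  ((\prod_(k < N) A k) i j =
   \sum_(h : {ffun 'I_N.+1 -> 'I_d.+1} | (h ord0 == i) && (h ord_max == j))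
     \prod_(k < N) A k (h (inord k)) (h (inord k.+1)))%R.
Proof.
elim: N A i => [|N IHN] A i.
  rewrite big_ord0 mxE.
  have uniq0 (k : 'I_1) : k = ord0 by apply: val_inj; case: k => [[]].
  case: eqVneq => [<-|neq_ij].
    rewrite (big_pred1 [ffun => i]) ?big_ord0 // => h /=.
    rewrite (uniq0 ord_max) andbb; apply/eqP/eqP => [hi|->]; last by rewrite ffunE.
    by apply/ffunP => k; rewrite ffunE (uniq0 k).
  rewrite big_pred0 // => h; rewrite (uniq0 ord_max).
  by apply/negP => /andP[/eqP-> /eqP eq_ij]; rewrite eq_ij eqxx in neq_ij.
rewrite big_ord_recl mxE.
under eq_bigr => l _ do rewrite IHN big_distrr /=.
pose cons_path (h : {ffun 'I_N.+1 -> 'I_d.+1}) : {ffun 'I_N.+2 -> 'I_d.+1} :=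
  [ffun k : 'I_N.+2 => if k == ord0 then i else h (inord k.-1)].
pose tail_path (h : {ffun 'I_N.+2 -> 'I_d.+1}) : {ffun 'I_N.+1 -> 'I_d.+1} :=
  [ffun k : 'I_N.+1 => h (inord k.+1)].
have consE h k : k <= N -> cons_path h (inord k.+1) = h (inord k).
  by move=> lekN; rewrite ffunE -val_eqE /= inordK.
rewrite [RHS](reindex_onto cons_path tail_path); last first.
  move=> h /andP[/eqP hi _]; apply/ffunP => k; rewrite !ffunE -val_eqE /=.
  case: eqP => [k0|/eqP k_neq0]; first by rewrite -hi; congr (h _); apply: val_inj.
  rewrite inordK ?prednK ?lt0n ?inord_val //.
  by have := ltn_ord k; lia.
have max_inord n : ord_max = inord n :> 'I_n.+1.
  by apply: val_inj; rewrite /= inordK.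
rewrite [RHS](eq_bigl (fun h : {ffun 'I_N.+1 -> 'I_d.+1} => h ord_max == j));
  last first.
  move=> h; rewrite {1}ffunE !eqxx /= max_inord consE // -max_inord.
  suff -> : tail_path (cons_path h) = h by rewrite eqxx andbT.
  by apply/ffunP => k; rewrite ffunE consE ?inord_val // -ltnS.
rewrite [RHS](partition_big (fun h : {ffun 'I_N.+1 -> 'I_d.+1} => h ord0) predT) //=.
apply: eq_bigr => l _; apply: eq_big => [h|h /andP[/eqP <- _]].
  by rewrite andbC.
rewrite big_ord_recl; congr (_ * _)%R.
  rewrite consE //.
  have inord0 n : inord 0 = ord0 :> 'I_n.+1 by apply: val_inj; rewrite /= inordK.
  by rewrite !inord0 ffunE eqxx.
by apply: eq_bigr => k _; rewrite /= !consE //; have := ltn_ord k; lia.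
Qed.

(** * Dimer covers of the straight snake graph as lattice paths *)

Section Flow.
Variables (N m : nat).

(** The multiplicity of the row b edge arriving at column k from the left.
    Written as a sum over at most one edge, it vanishes without any case
    distinction at the two ends of the row, where there is no such edge. *)
Definition flow (p : snake_edge N -> nat) (b : bool) (k : nat) : nat :=
  \sum_(j < N.-1 | j.+1 == k) p (inr (b, j)).

Lemma flow0 p b : flow p b 0 = 0.
Proof. by rewrite /flow big_pred0. Qed.

Lemma flow_last p b : flow p b N = 0.
Proof. by rewrite /flow big_pred0 // => j; have := ltn_ord j; lia. Qed.

Lemma flowS p b (j : 'I_N.-1) : flow p b j.+1 = p (inr (b, j)).
Proof. by rewrite /flow (big_pred1 j). Qed.

Lemma vertex_sum p (b : bool) (k : 'I_N) :
  \sum_(e | snake_inc (b, k) e) p e =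
  flow p b k + p (vert k) + flow p b k.+1.
Proof.
rewrite big_sumType /= (big_pred1 k); last by move=> j; rewrite /= eq_sym.
rewrite [flow p b k + _]addnC -addnA; congr (_ + _).
rewrite (eq_bigl (fun e : bool * 'I_N.-1 =>
  (e.1 == b) && ((k == e.2 :> nat) || (k == e.2.+1 :> nat)))); last first.
  by case=> b' j; rewrite /= eq_sym.
rewrite (eq_bigr (fun e => p (inr (e.1, e.2)))); last by case.
rewrite -(pair_big_dep (fun b' => b' == b)
  (fun _ (j : 'I_N.-1) => (k == j :> nat) || (k == j.+1 :> nat))
  (fun b' j => p (inr (b', j)))) /= big_pred1_eq.
(* The edges j with j.+1 = k arrive from the left, those with j = k leave. *)
rewrite /flow (bigID (fun j : 'I_N.-1 => j.+1 == k)) /=.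
by congr (_ + _); apply: eq_bigl => j; lia.
Qed.

(** The cover condition becomes a balance between what enters a column from the
    left and what leaves it to the right. *)
Lemma coverP (p : snake_edge N -> nat) :
  reflect (forall b (k : 'I_N), flow p b k + p (vert k) + flow p b k.+1 = m)
    (dimer_cover (@snake_inc N) m p).
Proof.
apply: (iffP forallP) => [cov b k|cov [b k]].
  by rewrite -vertex_sum (eqP (cov (b, k))).
by rewrite vertex_sum cov.
Qed.

(** The balance equations of the two rows share the vertical multiplicity and
    both start from 0, so they propagate the same value to the right. *)
Lemma flow_sym p b k :
  dimer_cover (@snake_inc N) m p -> k <= N -> flow p b k = flow p true k.
Proof.
move=> /coverP cov; elim: k => [|k IHk] lekN; first by rewrite !flow0.
have := cov b (Ordinal lekN); have := cov true (Ordinal lekN) => /=.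
by rewrite (IHk (ltnW lekN)); lia.
Qed.

Implicit Types (h : {ffun 'I_N.+1 -> 'I_m.+1})
  (p : {ffun snake_edge N -> 'I_m.+1}).

(** When h_k + h_(k+1) exceeds m the truncated subtraction returns a meaningless
    multiplicity 0; for paths from 0 to 0, [cover_of_in] shows that the result
    is then not a cover. *)
Definition cover_of h : {ffun snake_edge N -> 'I_m.+1} :=
  [ffun e : snake_edge N => match e return 'I_m.+1 with
             | inl k => inord (m - h (inord k) - h (inord k.+1))
             | inr (_, j) => h (inord j.+1)
             end].

Definition path_of p : {ffun 'I_N.+1 -> 'I_m.+1} :=
  [ffun k : 'I_N.+1 => inord (flow (fun e => p e) true k)].

(** The sum defining a flow has at most one term, so it is bounded by m and
    [inord] does not truncate it; this holds even if p is not a cover. *)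
Lemma path_ofE p k : k <= N -> path_of p (inord k) = flow (fun e => p e) true k :> nat.
Proof.
move=> lekN; rewrite ffunE !inordK //.
rewrite /flow; case: (pickP (fun j : 'I_N.-1 => j.+1 == k)) => [j /eqP jk|no_j].
  by rewrite (big_pred1 j) => [|j']; rewrite ?ltn_ord //= -jk.
by rewrite big_pred0.
Qed.

Lemma flow_cover_of h b k : h ord0 = ord0 -> h ord_max = ord0 -> k <= N ->
  flow (fun e => cover_of h e) b k = h (inord k).
Proof.
move=> h0 hN; case: k => [|k] lekN.
  rewrite flow0; have -> : inord 0 = ord0 :> 'I_N.+1.
    by apply: val_inj; rewrite /= inordK.
  by rewrite h0.
have [ltkN|geNk] := ltnP k N.-1.
  by rewrite (flowS _ _ (Ordinal ltkN)) ffunE.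
have -> : k.+1 = N by lia.
rewrite flow_last; have -> : inord N = ord_max :> 'I_N.+1.
  by apply: val_inj; rewrite /= inordK.
by rewrite hN.
Qed.

Lemma cover_ofK p : p \in Omega m N -> cover_of (path_of p) = p.
Proof.
rewrite inE => cov; apply/ffunP => -[k|[b j]]; rewrite ffunE; apply: val_inj.
  have ltkN := ltn_ord k; have /coverP/(_ true k) bal_k := cov.
  rewrite /= !path_ofE ?(ltnW ltkN) //.
  suff -> : m - flow (fun e => p e) true k - flow (fun e => p e) true k.+1
          = p (inl k) by rewrite inord_val.
  by rewrite -[X in X - _ - _]bal_k -addnA addKn addnK.
have ltjN : j < N by have := ltn_ord j; lia.
by rewrite /= path_ofE // -(flow_sym b cov) // flowS.
Qed.

(** At column k the sum of the three multiplicities is m exactly when the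
    subtraction m - h_k - h_(k+1) is not truncated. *)
Lemma cover_of_in h : h ord0 = ord0 -> h ord_max = ord0 ->
  (cover_of h \in Omega m N) =
  [forall k : 'I_N, h (inord k) + h (inord k.+1) <= m].
Proof.
move=> h0 hN; rewrite inE.
have bal b (k : 'I_N) : flow (fun e => cover_of h e) b k + cover_of h (vert k)
    + flow (fun e => cover_of h e) b k.+1
  = h (inord k) + (m - h (inord k) - h (inord k.+1)) + h (inord k.+1).
  have ltkN := ltn_ord k.
  rewrite !flow_cover_of ?(ltnW ltkN) // ffunE inordK //; lia.
apply/coverP/forallP => [cov k|le_m b k]; last first.
  by rewrite bal; have := le_m k; lia.
by have := cov true k; rewrite bal; lia.
Qed.

Lemma path_of_ends p : path_of p ord0 = ord0 /\ path_of p ord_max = ord0.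
Proof.
split; rewrite ffunE ?flow0 ?flow_last; apply: val_inj; rewrite /= inordK //.
Qed.

Lemma path_ofK h : h ord0 = ord0 -> h ord_max = ord0 ->
  path_of (cover_of h) = h.
Proof.
move=> h0 hN; apply/ffunP => k; apply: val_inj.
by rewrite -(inord_val k) /= path_ofE ?flow_cover_of // -ltnS.
Qed.

End Flow.

(** * Transfer matrices *)

Definition transfer (R : nzRingType) (m : nat) (f : nat -> R) : 'M[R]_m.+1 :=
  (\matrix_(i, j) if (i + j <= m)%N then f (m - i - j)%N else 0)%R.

(** The zero entries of the transfer matrices kill the paths that are not
    admissible, and the remaining paths from 0 to 0 are the covers. *)
Lemma cover_sum_transfer (R : comNzRingType) (m N : nat) (f : 'I_N -> nat -> R) :
  (\sum_(p in Omega m N) \prod_(k < N) f k (p (vert k)) =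
   (\prod_(k < N) transfer m (f k)) ord0 ord0)%R.
Proof.
rewrite mx_prod_path (reindex_onto (@cover_of N m) (@path_of N m)); last first.
  exact: cover_ofK.
pose ok (h : {ffun 'I_N.+1 -> 'I_m.+1}) :=
  [forall k : 'I_N, h (inord k) + h (inord k.+1) <= m].
rewrite [RHS](bigID ok) /= [X in (_ + X)%R]big1 ?addr0; last first.
  (* One forbidden step makes the whole product vanish. *)
  move=> h /andP[_] /forallPn[k /negbTE gt_m].
  by rewrite (bigD1 k) //= mxE gt_m mul0r.
apply: eq_big => h.
  apply/andP/andP => [[inO /eqP hK]|[/andP[/eqP h0 /eqP hN] ok_h]].
    have [] := path_of_ends (cover_of h); rewrite hK => h0 hN.
    by rewrite h0 hN eqxx /ok -cover_of_in.
  by rewrite cover_of_in // path_ofK.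
move=> /andP[inO /eqP hK].
have [] := path_of_ends (cover_of h); rewrite hK => h0 hN.
move: inO; rewrite cover_of_in // => /forallP ok_h.
by apply: eq_bigr => k _; rewrite mxE ok_h ffunE inordK // ltnS -subnDA leq_subr.
Qed.

(** * Brackets with binomial weights *)

Definition vert_wt (a v : nat) : int := 'C(a + v - 1, v).

Lemma Posz_bracket (m N : nat) (c : N.-tuple nat) :
  Posz (bracket m c) =
  (\prod_(k < N) transfer m (vert_wt (tnth c k)))%R ord0 ord0.
Proof.
rewrite -cover_sum_transfer /bracket (big_morph Posz PoszD (erefl 0%R)).
by apply: eq_bigr => p _; rewrite (big_morph Posz PoszM (erefl 1%R)).
Qed.

(** The bracket of a single column is itself a generating function of covers,
    namely the top-left entry of one transfer matrix. *)
Lemma Lambda_transfer m a : Lambda m a = transfer m (vert_wt a).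
Proof.
apply/matrixP => i j; rewrite !mxE; case: ifPn => [le_m|gt_m].
  have -> : (m%:Z + 2 - i.+1%:Z - j.+1%:Z = (m - i - j)%N :> int)%R by lia.
  by rewrite /= Posz_bracket big_ord1 mxE /= !subn0 (tnth_nth 0).
case def_k: (_ - _)%R => [k|k] //; lia.
Qed.

(** The binomial weights of the two added columns are all 1, which leaves room
    to encode the boundary conditions as indicator weights there. *)
Lemma bracket_bd_transfer (m n p q : nat) (a : n.-tuple nat) :
  Posz (bracket_bd m p q [tuple of 1 :: rcons a 1]) =
  (transfer m (fun v => (v == p)%:R)
   * (\prod_(k < n) Lambda m (tnth a k))
   * transfer m (fun v => (v == q)%:R))%R ord0 ord0.
Proof.
pose f (k : 'I_n.+2) (v : nat) : int :=
  if unlift ord0 k is Some k' then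
    if unlift ord_max k' is Some k'' then vert_wt (tnth a k'') v
    else (v == q)%:R%R
  else (v == p)%:R%R.
have lift_last : lift ord0 ord_max = ord_max :> 'I_n.+2 by apply: val_inj.
have widen_lift (k : 'I_n) : widen_ord (leqnSn n) k = lift ord_max k.
  by apply: val_inj; rewrite -[RHS]/(nat_of_ord _) lift_max.
have f0 v : f ord0 v = (v == p)%:R%R by rewrite /f unlift_none.
have fN v : f ord_max v = (v == q)%:R%R by rewrite /f -lift_last liftK unlift_none.
have fk k v : f (lift ord0 (lift ord_max k)) v = vert_wt (tnth a k) v.
  by rewrite /f !liftK.
(* Forgetting the body of f keeps simplification from unfolding it. *)
move: f f0 fN fk => f f0 fN fk.
transitivity ((\prod_(k < n.+2) transfer m (f k))%R ord0 ord0).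
  rewrite -cover_sum_transfer /bracket_bd big_mkcondr /=.
  rewrite (big_morph Posz PoszD (erefl 0%R)); apply: eq_bigr => d _.
  rewrite [in RHS]big_ord_recl [in RHS]big_ord_recr /= lift_last f0 fN.
  have wt1 k : tnth [tuple of 1 :: rcons a 1] k = 1 ->
      wt [tuple of 1 :: rcons a 1] d k = 1.
    by rewrite /wt => ->; rewrite add1n subn1 binn.
  case: eqP => _ /=; last by rewrite mul0r.
  case: eqP => _ /=; last by rewrite !mulr0.
  rewrite mul1r mulr1 big_ord_recl big_ord_recr lift_last /= !wt1; first last.
  - by rewrite (tnth_nth 0) /=.
  - by rewrite (tnth_nth 0) /= nth_rcons size_tuple ltnn eqxx.
  rewrite mul1n muln1 (big_morph Posz PoszM (erefl 1%R)).
  apply: eq_bigr => k _; rewrite widen_lift fk /wt /vert_wt.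
  have -> // : tnth [tuple of 1 :: rcons a 1] (lift ord0 (lift ord_max k)) = tnth a k.
  rewrite (tnth_nth 0) -widen_lift /= add0n nth_rcons size_tuple ltn_ord.
  by rewrite -tnth_nth.
rewrite big_ord_recl big_ord_recr /= lift_last mulrA.
congr (fun_of_matrix (_ * _ * _)%R ord0 ord0).
- by apply/matrixP => i j; rewrite !mxE f0.
- apply: eq_bigr => k _; rewrite Lambda_transfer widen_lift.
  by apply/matrixP => i j; rewrite !mxE fk.
by apply/matrixP => i j; rewrite !mxE fN.
Qed.

(** In the first row and the first column, one of the two horizontal
    multiplicities is 0, so the vertical one determines the other: it equals
    m - i only at index i. *)
Lemma transfer_delta m (i j : 'I_m.+1) :
  transfer m (fun v => (v == (m - i)%N)%:R%R : int) ord0 j = (j == i)%:R%R /\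
  transfer m (fun v => (v == (m - i)%N)%:R%R : int) j ord0 = (j == i)%:R%R.
Proof.
have := ltn_ord i; have := ltn_ord j; rewrite !ltnS => lejm leim.
have sub_eq : (m - j == m - i) = (j == i) by rewrite -val_eqE /=; lia.
by rewrite !mxE /= add0n addn0 lejm !subn0 sub_eq.
Qed.

Theorem theorem3p8 (m n : nat) (a : n.-tuple nat)
    (hm : 1 <= m) (hn : 1 <= n) (ha : forall k : 'I_n, 0 < tnth a k) :
  let X : 'M[int]_m.+1 := (\prod_(k < n) Lambda m (tnth a k))%R in
  let a1 : n.+2.-tuple nat := [tuple of 1 :: rcons a 1] in
  (forall i j : 'I_m.+1,
     X i j = Posz (bracket_bd m (m.+1 - i.+1) (m.+1 - j.+1) a1)) /\
  (X ord0 ord0 = Posz (bracket_bd m m m a1) /\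
   bracket_bd m m m a1 = bracket m a).
Proof.
move=> X a1.
have entry (i j : 'I_m.+1) :
    X i j = Posz (bracket_bd m (m.+1 - i.+1) (m.+1 - j.+1) a1).
  rewrite !subSS bracket_bd_transfer -/X mxE (bigD1 j) //= big1 => [|l neq_lj].
    rewrite (transfer_delta j j).2 eqxx mulr1 addr0 mxE (bigD1 i) //= big1 => [|l neq_li].
      by rewrite (transfer_delta i i).1 eqxx mul1r addr0.
    by rewrite (transfer_delta i l).1 (negbTE neq_li) mul0r.
  by rewrite (transfer_delta j l).2 (negbTE neq_lj) mulr0.
have X00 : X ord0 ord0 = Posz (bracket_bd m m m a1).
  by rewrite entry !subSS !subn0.
split=> //; split=> //.
suff [] : Posz (bracket_bd m m m a1) = Posz (bracket m a) by [].
rewrite -X00 Posz_bracket /X.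
by under eq_bigr => k _ do rewrite Lambda_transfer.
Qed.
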